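(* Let $q\geq 2$ be an integer, $\mathbb{F}=\{1,-1\}$, and let $A\in M_q(\mathbb{F})$. For $k\in\{0,1,\ldots,q-1\}$ let $\mathcal{S}_k$ denote the sequency of the $k$-th column of $A$ and let $p_k=\frac12|A_{0,k}-A_{q-1,k}|$. For $k_0,k_1\in\{0,1,\ldots,q-1\}$ let $\mathcal{S}_{k_1k_0}$ denote the sequency of the column of $A\otimes A$ with index $qk_1+k_0$. Then $$\mathcal{S}_{k_1k_0}=q\,\mathcal{S}_{k_0}+(q-1)\,p_{k_0}+(-1)^{p_{k_0}}\,\mathcal{S}_{k_1}.$$
   Context: $M_q(\mathbb{F})$ is the set of $q\times q$ matrices with entries in $\mathbb{F}=\{1,-1\}$; rows and columns are indexed starting from $0$. The sequency of $v=[v_0\ v_1\ \cdots\ v_{N-1}]^T\in\mathbb{F}^N$ is $\mathcal{S}_v=\frac12\sum_{k=0}^{N-2}|v_k-v_{k+1}|$ (the number of sign changes). $\otimes$ is the Kronecker product: $(A\otimes A)_{qi_1+i_0,\;qk_1+k_0}=A_{i_1,k_1}A_{i_0,k_0}$ for $i_0,i_1,k_0,k_1\in\{0,\ldots,q-1\}$. *)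

(* Defs.v *)
From mathcomp Require Import all_boot all_order all_algebra.
From mathcomp Require Export mxtens.

Set Implicit Arguments.
Unset Strict Implicit.
Unset Printing Implicit Defensive.

Import GRing.Theory.
Local Open Scope ring_scope.

Definition pm1 : {pred int} := pred2 1 (-1).

(* For each i the inner sum has the single term j = i + 1, or none when i is
   the last index. The halving is exact on +-1 vectors: see [sequency_double]. *)
Definition sequency (N : nat) (v : 'cV[int]_N) : nat :=
  (\sum_(i < N) \sum_(j < N | j == i.+1 :> nat) `|(v i ord0 - v j ord0)%R|)%N./2.

Definition ord_first (q : nat) (hq : (1 < q)%N) : 'I_q := Ordinal (ltnW hq).

Definition ord_last (q : nat) (hq : (1 < q)%N) : 'I_q := rev_ord (ord_first hq).

(* p_k; the halving is exact on +-1 matrices: see [end_change_double]. *)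
Definition end_change (q : nat) (hq : (1 < q)%N) (A : 'M[int]_q) (k : 'I_q) : nat :=
  `|(A (ord_first hq) k - A (ord_last hq) k)%R|%N./2.

Lemma val_ord_last (q : nat) (hq : (1 < q)%N) : ord_last hq = q.-1 :> nat.
Proof. by rewrite /= subn1. Qed.

Lemma pm1_dist_even (x y : int) : x \in pm1 -> y \in pm1 -> ~~ odd `|(x - y)%R|%N.
Proof. by move=> /pred2P[]-> /pred2P[]->. Qed.

Lemma sequency_double (N : nat) (v : 'cV[int]_N) : v \is a mxOver pm1 ->
  (sequency v).*2 =
  (\sum_(i < N) \sum_(j < N | j == i.+1 :> nat) `|(v i ord0 - v j ord0)%R|)%N.
Proof.
move=> /mxOverP hv; apply: even_halfK.
have even_sum (I : finType) (P : pred I) (F : I -> nat) :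
  (forall i, ~~ odd (F i)) -> ~~ odd (\sum_(i | P i) F i)%N.
  by move=> hF; elim/big_ind: _ => // a b /negbTE ha /negbTE hb; rewrite oddD ha hb.
by apply: (even_sum) => i; apply: (even_sum) => j; apply: pm1_dist_even.
Qed.

Lemma end_change_double (q : nat) (hq : (1 < q)%N) (A : 'M[int]_q) (k : 'I_q) :
  A \is a mxOver pm1 ->
  (end_change hq A k).*2 = `|(A (ord_first hq) k - A (ord_last hq) k)%R|%N.
Proof. by move=> /mxOverP hA; apply/even_halfK/pm1_dist_even. Qed.

(* Main.v *)
Require Import Defs.
From mathcomp Require Import all_boot all_order all_algebra.
From mathcomp Require Import mxtens.

Import GRing.Theory.
Local Open Scope ring_scope.

(** Write [a] and [b] for the columns [k1] and [k0] of [A]. The column of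
    [A *t A] under study is the concatenation of the [q] blocks
    [a_0 b, a_1 b, ..., a_(q-1) b]. A block is [b] up to a global sign, so its
    interior contributes the sequency of [b], whence [q] times that sequency
    ([sign_changes_blocks]). At each of the [q - 1] junctions the last entry
    [a_i b_(q-1)] meets [a_(i+1) b_0]. If [b_0 = b_(q-1)] the sign changes there
    exactly when [a] changes; otherwise exactly when [a] does not. The junctions
    thus contribute the number [s] of sign changes of [a], respectively
    [q - 1 - s], that is, [(q - 1) p + (-1) ^ p s] in both cases
    ([sum_junctions]).

    The argument is carried out on sequences indexed by [nat], where blocks can
    be shifted freely; [sequencyE] transfers it to column vectors. *)

Definition sign_changes (f : nat -> int) (n : nat) : nat :=
  \sum_(i < n) (f i != f i.+1).

Lemma eq_sign_changes (f g : nat -> int) (n : nat) :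
  (forall i, (i <= n)%N -> f i = g i) -> sign_changes f n = sign_changes g n.
Proof. by move=> efg; apply: eq_bigr => i _; rewrite !efg // ltnW. Qed.

Lemma sign_changesD (f : nat -> int) (m n : nat) :
  sign_changes f (m + n) =
  (sign_changes f m + sign_changes (fun i => f (m + i)%N) n)%N.
Proof.
rewrite /sign_changes big_split_ord /=; congr (_ + _)%N.
by apply: eq_bigr => i _; rewrite addnS.
Qed.

Lemma sign_changes_scale (c : int) (f : nat -> int) (n : nat) :
  c != 0 -> sign_changes (fun i => c * f i) n = sign_changes f n.
Proof. by move=> c0; apply: eq_bigr => i _; rewrite (inj_eq (mulfI c0)). Qed.

Lemma pm1_neq0 (x : int) : x \in pm1 -> x != 0.
Proof. by case/pred2P=> ->. Qed.

Lemma pm1_distE (x y : int) :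
  x \in pm1 -> y \in pm1 -> `|(x - y)%R|%N = (x != y).*2.
Proof. by move=> /pred2P[]-> /pred2P[]->. Qed.

(** Taking [f] on all of [nat] makes the entry after the [i]-th one available
    as [f i.+1], without proving that it is in range. For [N = 0] the truncated
    predecessor gives the right count, zero. *)
Lemma sequencyE (N : nat) (v : 'cV[int]_N) (f : nat -> int) :
  v \is a mxOver pm1 -> (forall i : 'I_N, v i ord0 = f i) ->
  sequency v = sign_changes f N.-1.
Proof.
case: N v => [|N] v /mxOverP pm1v vf.
  by rewrite /sequency /sign_changes !big_ord0.
suff -> : sequency v = (sign_changes f N).*2./2 by rewrite doubleK.
rewrite /sequency big_ord_recr /= [X in (_ + X)%N]big_pred0 ?addn0; last first.
  by move=> j; apply/eqP => jN; have := ltn_ord j; rewrite jN ltnn.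
congr _./2; rewrite /sign_changes -mul2n big_distrr /=.
apply: eq_bigr => i _; rewrite (big_pred1 (lift ord0 i)) => [|j]; last first.
  by rewrite /= -val_eqE /= /bump leq0n.
by rewrite pm1_distE // !vf mul2n.
Qed.

(** Multiplying by the nonzero [a i] keeps distinct entries distinct, so the
    interior of every block has as many changes as [b]; the factors [a i] are
    felt only at the junctions, which the sum on the right counts. Stopping at
    step [m * n.+1 + n] means ending on the last entry of block [m]. *)
Lemma sign_changes_blocks (n m : nat) (a b f : nat -> int) :
  (forall i, a i != 0) ->
  (forall i j, (j <= n)%N -> f (i * n.+1 + j)%N = a i * b j) ->
  sign_changes f (m * n.+1 + n) =
  (m.+1 * sign_changes b n + \sum_(i < m) (a i * b n != a i.+1 * b 0%N)%R)%N.
Proof.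
move=> a0 fab.
have block i : sign_changes (fun j => f (i * n.+1 + j)%N) n = sign_changes b n.
  by rewrite (@eq_sign_changes _ (fun j => a i * b j)) ?sign_changes_scale // => j /fab.
elim: m => [|m IHm]; first by rewrite big_ord0 addn0 mul1n -(block 0%N).
(* One more block costs one junction step, then [n] interior steps. *)
rewrite sign_changesD block mulSnr addnS.
rewrite {1}/sign_changes big_ord_recr -/(sign_changes _ _) IHm /= big_ord_recr /=.
rewrite fab // -addnS -mulSnr -[(m.+1 * n.+1)%N]addn0 fab // [in RHS]mulSnr.
by rewrite -[X in (X + _)%N = _]addnA addnAC.
Qed.

Lemma pm1_junction (x y z t : int) :
  x \in pm1 -> y \in pm1 -> z \in pm1 -> t \in pm1 ->
  (x * z != y * t) = (x != y) (+) (t != z).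
Proof. by move=> /pred2P[]-> /pred2P[]-> /pred2P[]-> /pred2P[]->. Qed.

(** Taking the exclusive or of the changes of [a] with a constant bit [p] either
    keeps or complements each of them, hence the affine formula in [p]. *)
Lemma sum_junctions (m : nat) (a : nat -> int) (z t : int) :
  (forall i, a i \in pm1) -> z \in pm1 -> t \in pm1 ->
  (\sum_(i < m) (a i * z != a i.+1 * t)%R)%N%:Z =
  m%:Z * (t != z)%:Z + (-1) ^+ (t != z) * (sign_changes a m)%:Z.
Proof.
move=> pm1a pm1z pm1t; rewrite /sign_changes.
elim: m => [|m IHm]; first by rewrite !big_ord0 mul0r mulr0.
have xorE (c p : bool) : (c (+) p)%:Z = p%:Z + (-1) ^+ p * c%:Z.
  by case: c; case: p.
rewrite !big_ord_recr /= !PoszD IHm pm1_junction // xorE.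
by rewrite intS mulrDl mul1r mulrDr addrACA [(_ + (t != z)%:Z)%R]addrC.
Qed.

Theorem lemma3p1 (q : nat) (hq : (1 < q)%N) (A : 'M[int]_q)
    (hA : A \is a mxOver pm1) (k0 k1 : 'I_q) (k : 'I_(q * q))
    (hk : (k = q * k1 + k0 :> nat)%N) :
  (sequency (col k (A *t A)))%:Z =
    q%:Z * (sequency (col k0 A))%:Z
    + (q%:Z - 1) * (end_change hq A k0)%:Z
    + (-1) ^+ end_change hq A k0 * (sequency (col k1 A))%:Z.
Proof.
case: q => [//|n] in hq A hA k0 k1 k hk *.
have pm1A := mxOverP hA.
pose a i := A (inord i) k1; pose b i := A (inord i) k0.
pose f i := a (i %/ n.+1)%N * b (i %% n.+1)%N.
have colE l (i : 'I_n.+1) : col l A i ord0 = A (inord i) l.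
  by rewrite mxE inord_val.
have pm1col l : col l A \is a mxOver pm1.
  by apply/mxOverP => i j; rewrite mxE.
have -> : k = mxtens_index (k1, k0) by apply: val_inj; rewrite /= hk mulnC.
have colf i : col (mxtens_index (k1, k0)) (A *t A) i ord0 = f i.
  case: (mxtens_indexP i) => i1 i0; rewrite mxE tensmxE /f /=.
  by rewrite divnMDl // modnMDl divn_small // modn_small // addn0 /a /b !inord_val.
have pm1f : col (mxtens_index (k1, k0)) (A *t A) \is a mxOver pm1.
  apply/mxOverP => i j; rewrite ord1 colf /f.
  by case/pred2P: (pm1A (inord (i %/ n.+1)) k1) => ea;
     case/pred2P: (pm1A (inord (i %% n.+1)) k0) => eb; rewrite /a /b ea eb.
have -> : end_change hq A k0 = (b 0%N != b n).
  rewrite /end_change pm1_distE // doubleK /b.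
  by congr (nat_of_bool (A _ _ != A _ _)); apply: val_inj;
    rewrite /= inordK // subn1.
rewrite (sequencyE _ _ f) // (sequencyE _ (col k0 A) b) //.
rewrite (sequencyE _ (col k1 A) a) //=.
(* The [q * q - 1] steps are [n = q - 1] full blocks followed by [n] steps. *)
rewrite -[X in sign_changes f X]/(n + n * n.+1)%N addnC.
rewrite (@sign_changes_blocks n n a b f); last 2 first.
- by move=> i; apply: pm1_neq0; apply: pm1A.
- move=> i j lejn; rewrite /f divnMDl // modnMDl divn_small // modn_small //.
  by rewrite addn0.
have pm1a i : a i \in pm1 by apply: pm1A.
have pm1b i : b i \in pm1 by apply: pm1A.
rewrite PoszD PoszM sum_junctions //.
by rewrite addrA intS [1 + n%:Z]addrC addrK.
Qed.
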